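(* Let $A \in \mathbb{C}_{n,m}$ and $D, E \in \mathbb{C}_{m,n}$. The following statements are equivalent. (i) The matrix $A$ is left $(D,E)$-invertible. (ii) $\mathcal{N}(D)=\mathcal{N}(EAD)$. (iii) $\dim \mathcal{N}(D)=\dim\mathcal{N}(EAD)$. (iv) $\mathrm{rk}(D)=\mathrm{rk}(EAD)$. (v) $\mathcal{N}(EA) \cap \mathcal{R}(D)=0$. (vi) $\mathcal{R}(AD) \cap \mathcal{N}(E)=0$ and $\mathrm{rk}(D)=\mathrm{rk}(AD)$.
   Context: $\mathbb{C}_{m,n}$ is the set of $m\times n$ complex matrices ($m,n\in\mathbb{N}$). For a matrix $M\in\mathbb{C}_{p,q}$, $\mathcal{R}(M)=\{M\mathbf{x}:\mathbf{x}\in\mathbb{C}^q\}$ is its column space, $\mathcal{N}(M)=\{\mathbf{x}\in\mathbb{C}^q: M\mathbf{x}=\mathbf{0}\}$ its null space, and $\mathrm{rk}(M)$ its rank. For $A \in \mathbb{C}_{n,m}$ and $D, E \in \mathbb{C}_{m,n}$, $A$ is left $(D,E)$-invertible if there exists $C\in\mathbb{C}_{m,n}$ such that $CAD=D$ and $\mathcal{N}(E)\subseteq\mathcal{N}(C)$; such a $C$ is called a left $(D,E)$-inverse of $A$. *)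

(* Defs.v *)
From mathcomp Require Import all_boot all_order all_algebra.
From mathcomp Require Import complex reals.

Set Implicit Arguments.
Unset Strict Implicit.
Unset Printing Implicit Defensive.

Import GRing.Theory.
Local Open Scope ring_scope.

(* Vectors of C^q are column vectors on which matrices act on the left, as in
   the source, unlike the row-space conventions of mxalgebra. *)
Definition colspace (F : fieldType) (p q : nat) (M : 'M[F]_(p, q)) :
    {vspace 'cV[F]_p} :=
  limg (linfun (mulmx M : 'cV[F]_q -> 'cV[F]_p)).

Definition nullspace (F : fieldType) (p q : nat) (M : 'M[F]_(p, q)) :
    {vspace 'cV[F]_q} :=
  lker (linfun (mulmx M : 'cV[F]_q -> 'cV[F]_p)).

Lemma mem_colspaceP (F : fieldType) (p q : nat) (M : 'M[F]_(p, q))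
    (y : 'cV[F]_p) :
  reflect (exists x : 'cV[F]_q, y = M *m x) (y \in colspace M).
Proof.
apply: (iffP memv_imgP) => [[x _ ->]|[x ->]]; exists x; rewrite ?memvf //.
  by rewrite lfunE.
by rewrite lfunE.
Qed.

Lemma mem_nullspace (F : fieldType) (p q : nat) (M : 'M[F]_(p, q))
    (x : 'cV[F]_q) :
  (x \in nullspace M) = (M *m x == 0).
Proof. by rewrite memv_ker lfunE. Qed.

Definition left_DE_inverse (F : fieldType) (m n : nat) (A : 'M[F]_(n, m))
    (D E C : 'M[F]_(m, n)) : Prop :=
  C *m A *m D = D /\ (nullspace E <= nullspace C)%VS.

Definition left_DE_invertible (F : fieldType) (m n : nat) (A : 'M[F]_(n, m))
    (D E : 'M[F]_(m, n)) : Prop :=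
  exists C : 'M[F]_(m, n), left_DE_inverse A D E C.

(* Main.v *)
Require Import Defs.
From mathcomp Require Import all_boot all_order all_algebra.
From mathcomp Require Import complex reals.

Set Implicit Arguments.
Unset Strict Implicit.
Unset Printing Implicit Defensive.

Import GRing.Theory.
Local Open Scope ring_scope.

(** The theorem holds over every field, and each of the six conditions says
    that [D] is recovered from [E *m A *m D] by a left factor, i.e. that
    [D = X *m (E *m A *m D)] for some [X]; then [X *m E] is a left
    [(D, E)]-inverse of [A].  In the row-space language of matrices this is
    [(D <= E *m A *m D)%MS], which can also be reached through the chain
    [(D <= A *m D <= E *m (A *m D))%MS] of the last condition.

    The bridge to the column-vector notions is the duality [nullspaceS]: an
    inclusion of null spaces is the reverse inclusion of row spaces.  It turns
    [nullspace E <= nullspace C] into a factorization [C = X *m E], and a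
    trivial intersection of [nullspace M] with [colspace N] into
    [(N <= M *m N)%MS] ([nullspace_capv_colspace]).  Ranks enter because the
    row space of [B *m D] always lies in that of [D], so equality of ranks
    forces equality of row spaces ([submx_mull_rank]); dimensions of null
    spaces enter through rank-nullity ([dim_nullspace]). *)

Lemma nullspaceP (F : fieldType) (p1 p2 q : nat) (M : 'M[F]_(p1, q)) (N : 'M[F]_(p2, q)) :
  reflect (forall x : 'cV[F]_q, M *m x = 0 -> N *m x = 0)
          (nullspace M <= nullspace N)%VS.
Proof.
apply: (iffP subvP) => sMN x.
  by move/eqP; rewrite -mem_nullspace => /sMN; rewrite mem_nullspace => /eqP.
by rewrite !mem_nullspace => /eqP/sMN/eqP.
Qed.

(** The columns of [cokermx M] lie in the null space of [M], and the row space
    of [M] consists of the rows that annihilate them; hence a null space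
    determines the row space, with inclusions reversed. *)
Lemma nullspaceS (F : fieldType) (p1 p2 q : nat) (M : 'M[F]_(p1, q)) (N : 'M[F]_(p2, q)) :
  (nullspace M <= nullspace N)%VS = (N <= M)%MS.
Proof.
apply/nullspaceP/submxP => [sMN | [X ->] x Mx0]; last first.
  by rewrite -mulmxA Mx0 mulmx0.
apply/submxP; rewrite submxE; apply/eqP/matrixP => i j.
have /colP/(_ i): N *m col j (cokermx M) = 0.
  by apply: sMN; rewrite colE mulmxA mulmx_coker mul0mx.
by rewrite colE mulmxA -colE !mxE.
Qed.

(** In the factorization [M = col_base M *m row_base M] the right factor is
    onto and the left one is injective, so the column space of [M] is the
    isomorphic image of the space of columns of height [\rank M]. *)
Lemma dim_colspace (F : fieldType) (p q : nat) (M : 'M[F]_(p, q)) : \dim (colspace M) = \rank M.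
Proof.
have -> : colspace M = colspace (col_base M).
  apply/vspaceP=> y; apply/mem_colspaceP/mem_colspaceP => -[x ->].
    by exists (row_base M *m x); rewrite mulmxA mulmx_base.
  have /row_freeP[B rB1] := row_base_free M.
  have := mulmxA (col_base M) (row_base M) B.
  by rewrite mulmx_base rB1 mulmx1 => ->; exists (B *m x); rewrite mulmxA.
rewrite limg_dim_eq; first by rewrite dimvf dim_matrix mulr1.
have /row_fullP[B Bc1] := col_base_full M.
apply/eqP; rewrite capfv -subv0; apply/subvP=> x.
rewrite memv_ker lfunE /= memv0 => /eqP cx0.
by rewrite -[x]mul1mx -Bc1 -mulmxA cx0 mulmx0.
Qed.

Lemma dim_nullspace (F : fieldType) (p q : nat) (M : 'M[F]_(p, q)) :
  (\dim (nullspace M) + \rank M)%N = q.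
Proof.
rewrite -dim_colspace -[RHS]mulr1 -[RHS](dim_matrix F) -dimvf.
by rewrite -(limg_ker_dim (linfun (mulmx M)) fullv) capfv.
Qed.

Lemma submx_mull_rank (F : fieldType) (p q r : nat) (B : 'M[F]_(r, p)) (D : 'M[F]_(p, q)) :
  (\rank D == \rank (B *m D)) = (D <= B *m D)%MS.
Proof. by rewrite eq_sym (mxrank_leqif_sup (submxMl B D)). Qed.

(** Triviality of the intersection says that [M *m N *m x = 0] implies
    [N *m x = 0], i.e. that every null vector of [M *m N] is one of [N], which
    [nullspaceS] restates as an inclusion of row spaces. *)
Lemma nullspace_capv_colspace (F : fieldType) (p q r : nat)
    (M : 'M[F]_(p, q)) (N : 'M[F]_(q, r)) :
  ((nullspace M :&: colspace N)%VS == 0%VS) = (N <= M *m N)%MS.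
Proof.
rewrite -nullspaceS -subv0; apply/subvP/nullspaceP => [cap0 x MNx0 | sMN y].
  apply/eqP; rewrite -memv0; apply: cap0.
  rewrite memv_cap mem_nullspace mulmxA MNx0 eqxx /=.
  by apply/mem_colspaceP; exists x.
rewrite memv_cap mem_nullspace memv0 => /andP[/eqP My0 /mem_colspaceP[x defy]].
by apply/eqP; rewrite defy sMN // -mulmxA -defy.
Qed.

Theorem theorem3p2 (R : realType) (m n : nat)
    (A : 'M[R[i]]_(n, m)) (D E : 'M[R[i]]_(m, n)) :
  [<-> left_DE_invertible A D E;
       nullspace D = nullspace (E *m A *m D);
       \dim (nullspace D) = \dim (nullspace (E *m A *m D));
       \rank D = \rank (E *m A *m D);
       (nullspace (E *m A) :&: colspace D)%VS = 0%VS;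
       (colspace (A *m D) :&: nullspace E)%VS = 0%VS
         /\ \rank D = \rank (A *m D)].
Proof.
tfae.
- case=> C [CAD]; rewrite nullspaceS => /submxP[X defC].
  apply/eqP; rewrite eqEsubv !nullspaceS submxMl /=.
  by apply/submxP; exists X; rewrite !mulmxA -defC.
- by move->.
- move=> eq_dim; apply: (@addnI (\dim (nullspace D))).
  by rewrite {2}eq_dim !dim_nullspace.
- by move=> /eqP; rewrite submx_mull_rank -nullspace_capv_colspace => /eqP.
- move=> /eqP; rewrite nullspace_capv_colspace => sD_EAD; split; apply/eqP.
    rewrite capvC nullspace_capv_colspace mulmxA.
    exact: submx_trans (submxMl A D) sD_EAD.
  by rewrite submx_mull_rank (submx_trans sD_EAD) // -mulmxA submxMl.
- rewrite capvC => -[/eqP + /eqP].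
  rewrite nullspace_capv_colspace submx_mull_rank => sAD_EAD sD_AD.
  have /submxP[X defD] := submx_trans sD_AD sAD_EAD.
  exists (X *m E); split; first by rewrite [RHS]defD !mulmxA.
  by rewrite nullspaceS submxMl.
Qed.
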